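(* Let $\mathcal A$ be a $\sigma$-bounded ordered $^*$-algebra. Then $\mathcal A$ has a faithful representation as operators if and only if $\mathcal A$ is closed.
   Context: An ordered vector space is a real vector space $V$ with a partial order $\le$ such that $v\le w$ implies $u+v\le u+w$ and $\lambda v\le\lambda w$ for all $u\in V$, $\lambda\in[0,\infty[$; $V^+=\{v\in V:0\le v\}$. $V$ is Archimedean if, whenever $v\in V$, $w\in V^+$ satisfy $v\le\epsilon w$ for all $\epsilon\in\,]0,\infty[$, then $v\le0$. $V$ is $\sigma$-bounded if there is an increasing sequence $(\hat v_n)_{n\in\mathbb N}$ in $V^+$ such that for all $v\in V$ there is $n\in\mathbb N$ with $-\hat v_n\le v\le\hat v_n$. A $^*$-algebra is a unital associative complex algebra $\mathcal A$ (unit $1$) with an antilinear involution $^*$ satisfying $(ab)^*=b^*a^*$. $\mathcal A_{\mathrm H}=\{a\in\mathcal A:a=a^*\}$ is the real vector space of Hermitian elements. An ordered $^*$-algebra is a $^*$-algebra $\mathcal A$ with a partial order $\le$ on $\mathcal A_{\mathrm H}$ making $\mathcal A_{\mathrm H}$ an ordered vector space such that $0\le 1$ and $a^*ba\in\mathcal A_{\mathrm H}^+$ for all $a\in\mathcal A$, $b\in\mathcal A_{\mathrm H}^+$. $\mathcal A$ is called $\sigma$-bounded if $\mathcal A_{\mathrm H}$ is $\sigma$-bounded, and closed if $\mathcal A_{\mathrm H}$ is Archimedean. For a pre-Hilbert space $\mathcal D$ (complex vector space with inner product, not necessarily complete), $\mathcal L^*(\mathcal D)$ is the $^*$-algebra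 of all linear endomorphisms $a$ of $\mathcal D$ for which there is a (necessarily unique) linear endomorphism $a^*$ of $\mathcal D$ with $\langle\phi|a(\psi)\rangle=\langle a^*(\phi)|\psi\rangle$ for all $\phi,\psi\in\mathcal D$; it is an ordered $^*$-algebra in which a Hermitian $a$ is positive iff $\langle\phi|a(\phi)\rangle\ge0$ for all $\phi\in\mathcal D$. A faithful representation as operators of $\mathcal A$ is a pair $(\mathcal D,\pi)$ of a pre-Hilbert space $\mathcal D$ and a unital $^*$-homomorphism $\pi:\mathcal A\to\mathcal L^*(\mathcal D)$ whose restriction to $\mathcal A_{\mathrm H}\to\mathcal L^*(\mathcal D)_{\mathrm H}$ is an order embedding, i.e. it is injective and for all $a,b\in\mathcal A_{\mathrm H}$, $a\le b$ if and only if $\pi(a)\le\pi(b)$. *)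

(* Defs.v *)
From HB Require Import structures.
From mathcomp Require Import all_boot all_order all_algebra.
From mathcomp Require Import complex.
From mathcomp Require Import boolp reals.

Set Implicit Arguments.
Unset Strict Implicit.
Unset Printing Implicit Defensive.

Import Order.TTheory GRing.Theory Num.Theory.

Local Open Scope ring_scope.

HB.mixin Record isOrderedVectorSpace (R : realType) V
    of Num.POrderedZmodule V & GRing.Lmodule R V := {
  ovs_leD : forall u v w : V, v <= w -> u + v <= u + w;
  ovs_leZ : forall (l : R) (v w : V), 0 <= l -> v <= w -> l *: v <= l *: w
}.

#[short(type="orderedVectorSpaceType")]
HB.structure Definition OrderedVectorSpace (R : realType) :=
  {V of Num.POrderedZmodule V & GRing.Lmodule R V & isOrderedVectorSpace R V}.

Definition archimedean (R : realType) (V : orderedVectorSpaceType R) : Prop :=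
  forall v w : V, 0 <= w -> (forall e : R, 0 < e -> v <= e *: w) -> v <= 0.

Definition sigma_bounded (R : realType) (V : orderedVectorSpaceType R) : Prop :=
  exists vhat : nat -> V,
    [/\ forall n, 0 <= vhat n,
        forall m n, (m <= n)%N -> vhat m <= vhat n
      & forall v : V, exists n, - vhat n <= v <= vhat n].

(* MathComp's algebras are nontrivial rings by definition; the multiplication
   is given here on top of a complex vector space so that the zero algebra is
   a *-algebra, as is the algebra of endomorphisms of the zero space. *)
HB.mixin Record isStarAlgebra (R : realType) A of GRing.Lmodule R[i] A := {
  sa_one : A;
  sa_mul : A -> A -> A;
  sa_mulA : associative sa_mul;
  sa_mul1l : left_id sa_one sa_mul;
  sa_mul1r : right_id sa_one sa_mul;
  sa_mulDl : left_distributive sa_mul +%R;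
  sa_mulDr : right_distributive sa_mul +%R;
  sa_scaleAl : forall (k : R[i]) (a b : A),
    k *: sa_mul a b = sa_mul (k *: a) b;
  sa_scaleAr : forall (k : R[i]) (a b : A),
    k *: sa_mul a b = sa_mul a (k *: b);
  star : A -> A;
  star_antilinear : forall (k : R[i]) (a b : A),
    star (k *: a + b) = k^* *: star a + star b;
  starK : involutive star;
  sa_starM : forall a b : A, star (sa_mul a b) = sa_mul (star b) (star a)
}.

#[short(type="starAlgebraType")]
HB.structure Definition StarAlgebra (R : realType) :=
  {A of GRing.Lmodule R[i] A & isStarAlgebra R A}.

#[non_forgetful_inheritance]
HB.instance Definition _ (R : realType) (A : starAlgebraType R) :=
  GRing.Zmodule_isPzRing.Build A (@sa_mulA R A) (@sa_mul1l R A)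
    (@sa_mul1r R A) (@sa_mulDl R A) (@sa_mulDr R A).

Section StarAlgebraTheory.
Variables (R : realType) (A : starAlgebraType R).
Implicit Types (a b : A) (k : R[i]).

Lemma starM a b : star (a * b) = star b * star a.
Proof. exact: sa_starM. Qed.

Lemma starD a b : star (a + b) = star a + star b.
Proof. by have := star_antilinear 1 a b; rewrite conjC1 !scale1r. Qed.

Lemma star0 : star (0 : A) = 0.
Proof. by apply: (addrI (star 0)); rewrite -starD !addr0. Qed.

Lemma starZ k a : star (k *: a) = k^* *: star a.
Proof. by have := star_antilinear k a 0; rewrite star0 !addr0. Qed.

Lemma starN a : star (- a) = - star a.
Proof. by apply: (addrI (star a)); rewrite -starD !subrr star0. Qed.

Lemma star1 : star (1 : A) = 1.
Proof. by rewrite -[LHS]mulr1 -{2}(starK 1) -starM mulr1 starK. Qed.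

Definition hermitian_pred : pred A := fun a => star a == a.

Lemma hermitian_zmod_closed : zmod_closed hermitian_pred.
Proof.
split=> [|a b]; rewrite !unfold_in /= ?star0 //.
by move=> /eqP ha /eqP hb; rewrite starD starN ha hb.
Qed.

HB.instance Definition _ :=
  GRing.isZmodClosed.Build A hermitian_pred hermitian_zmod_closed.

End StarAlgebraTheory.

Record herm (R : realType) (A : starAlgebraType R) := Herm {
  herm_val :> A;
  herm_valP : herm_val \in @hermitian_pred R A
}.

HB.instance Definition _ (R : realType) (A : starAlgebraType R) :=
  [isSub for @herm_val R A].
HB.instance Definition _ (R : realType) (A : starAlgebraType R) :=
  [Choice of herm A by <:].
HB.instance Definition _ (R : realType) (A : starAlgebraType R) :=
  [SubChoice_isSubZmodule of herm A by <:].

Section HermTheory.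
Variables (R : realType) (A : starAlgebraType R).
Implicit Types (v w : herm A) (r s : R).

Lemma herm_star v : star (v : A) = v.
Proof. exact/eqP/(herm_valP v). Qed.

Lemma herm_scale_subproof r v : (r%:C)%C *: (v : A) \in @hermitian_pred R A.
Proof. by rewrite unfold_in starZ herm_star [_^*]conjc_real. Qed.

Definition herm_scale r v : herm A := Herm (herm_scale_subproof r v).

Lemma herm_scaleA r s v : herm_scale r (herm_scale s v) = herm_scale (r * s) v.
Proof. by apply: val_inj; rewrite /= scalerA rmorphM. Qed.

Lemma herm_scale1 : left_id 1 herm_scale.
Proof. by move=> v; apply: val_inj; rewrite /= rmorph1 scale1r. Qed.

Lemma herm_scaleDr : right_distributive herm_scale +%R.
Proof. by move=> r v w; apply: val_inj; rewrite /= scalerDr. Qed.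

Lemma herm_scaleDl v : {morph herm_scale^~ v : r s / r + s}.
Proof. by move=> r s; apply: val_inj; rewrite /= rmorphD scalerDl. Qed.

HB.instance Definition _ := GRing.Zmodule_isLmodule.Build R (herm A)
  herm_scaleA herm_scale1 herm_scaleDr herm_scaleDl.

Lemma herm_one_subproof : (1 : A) \in @hermitian_pred R A.
Proof. by rewrite unfold_in star1. Qed.

Definition herm_one : herm A := Herm herm_one_subproof.

Lemma herm_conj_subproof (a : A) v : star a * (v : A) * a \in @hermitian_pred R A.
Proof. by rewrite unfold_in !starM starK herm_star mulrA. Qed.

Definition herm_conj (a : A) v : herm A := Herm (herm_conj_subproof a v).

End HermTheory.

Arguments herm_one {R A}.

HB.mixin Record isOrderedStarAlgebra (R : realType) A of StarAlgebra R A := {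
  herm_le : rel (herm A);
  herm_le_refl : reflexive herm_le;
  herm_le_anti : antisymmetric herm_le;
  herm_le_trans : transitive herm_le;
  herm_leD : forall u v w : herm A, herm_le v w -> herm_le (u + v) (u + w);
  herm_leZ : forall (l : R) (v w : herm A),
    0 <= l -> herm_le v w -> herm_le (l *: v) (l *: w);
  herm_le01 : herm_le 0 herm_one;
  herm_le_conj : forall (a : A) (b : herm A),
    herm_le 0 b -> herm_le 0 (herm_conj a b)
}.

#[short(type="orderedStarAlgebraType")]
HB.structure Definition OrderedStarAlgebra (R : realType) :=
  {A of StarAlgebra R A & isOrderedStarAlgebra R A}.

(* The ring structure is keyed on the carrier projection of each structure, so
   it is declared again here. *)
#[non_forgetful_inheritance]
HB.instance Definition _ (R : realType) (A : orderedStarAlgebraType R) :=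
  GRing.Zmodule_isPzRing.Build A (@sa_mulA R A) (@sa_mul1l R A)
    (@sa_mul1r R A) (@sa_mulDl R A) (@sa_mulDr R A).

HB.instance Definition _ (R : realType) (A : orderedStarAlgebraType R) :=
  Order.Le_isPOrder.Build ring_display (herm A)
    (@herm_le_refl R A) (@herm_le_anti R A) (@herm_le_trans R A).
HB.instance Definition _ (R : realType) (A : orderedStarAlgebraType R) :=
  isOrderedVectorSpace.Build R (herm A) (@herm_leD R A) (@herm_leZ R A).

Definition sigma_bounded_algebra (R : realType) (A : orderedStarAlgebraType R)
  : Prop := sigma_bounded (herm A : orderedVectorSpaceType R).

Definition closed_algebra (R : realType) (A : orderedStarAlgebraType R)
  : Prop := archimedean (herm A : orderedVectorSpaceType R).

Record starHom (R : realType) (A B : starAlgebraType R) := StarHom {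
  star_hom :> A -> B;
  star_hom_linear : linear star_hom;
  star_hom1 : star_hom 1 = 1;
  star_homM : {morph star_hom : a b / a * b};
  star_homS : {morph star_hom : a / star a}
}.

Section StarHomTheory.
Variables (R : realType) (A B : starAlgebraType R) (f : starHom A B).

Lemma herm_hom_subproof (v : herm A) : f v \in @hermitian_pred R B.
Proof. by rewrite unfold_in -star_homS herm_star. Qed.

Definition herm_hom (v : herm A) : herm B := Herm (herm_hom_subproof v).

End StarHomTheory.

Definition order_embedding (R : realType) (V W : orderedVectorSpaceType R)
    (f : V -> W) : Prop :=
  injective f /\ forall v w : V, v <= w <-> f v <= f w.

(* MathComp's forms are linear in the first argument and conjugate-linear in
   the second one. *)
Definition bracket (R : realType) (D : lmodType R[i])
    (dot : {dot D for @Num.conj R[i]}) (phi psi : D) : R[i] := dot psi phi.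

Section AdjointableOperators.
Variables (R : realType) (D : lmodType R[i]) (dot : {dot D for @Num.conj R[i]}).
Implicit Types (phi psi : D) (k : R[i]).

Local Notation "''[' phi | psi ]" := (bracket dot phi psi).

Definition is_adjoint (a b : D -> D) : Prop :=
  forall phi psi, '[phi | a psi] = '[b phi | psi].

(* L^*(D), the *-algebra of adjointable operators on the pre-Hilbert space D. *)
Record adjointable := Adjointable {
  adjointable_fun :> D -> D;
  adjointable_linear : linear adjointable_fun;
  adjointableP : exists b : D -> D, linear b /\ is_adjoint adjointable_fun b
}.
Implicit Types (a b c : adjointable).

HB.instance Definition _ := gen_eqMixin adjointable.
HB.instance Definition _ := gen_choiceMixin adjointable.

Lemma adjointable_ext a b : (forall phi, a phi = b phi) -> a = b.
Proof.
case: a b => [a la ha] [b lb hb] /= /funext eab; subst b.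
by congr Adjointable; exact: Prop_irrelevance.
Qed.

Lemma bracketDl phi phi' psi :
  '[phi + phi' | psi] = '[phi | psi] + '[phi' | psi].
Proof. exact: linearDr. Qed.

Lemma bracketZl k phi psi : '[k *: phi | psi] = k^* * '[phi | psi].
Proof. exact: linearZr_LR. Qed.

Lemma bracketDr phi psi psi' :
  '[phi | psi + psi'] = '[phi | psi] + '[phi | psi'].
Proof. exact: linearDl. Qed.

Lemma bracketZr k phi psi : '[phi | k *: psi] = k * '[phi | psi].
Proof. exact: linearZl_LR. Qed.

Lemma bracketC phi psi : '[phi | psi] = ('[psi | phi])^*.
Proof. by rewrite /bracket hermC expr0 mul1r. Qed.

Lemma bracket_gt0 phi : phi != 0 -> 0 < '[phi | phi].
Proof. exact: neq0_dnorm_gt0. Qed.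

Lemma bracket0r phi : '[phi | 0] = 0.
Proof. by apply: (addrI '[phi | 0]); rewrite -bracketDr !addr0. Qed.

Lemma bracketNr phi psi : '[phi | - psi] = - '[phi | psi].
Proof. by apply: (addrI '[phi | psi]); rewrite -bracketDr !subrr bracket0r. Qed.

Lemma bracketNl phi psi : '[- phi | psi] = - '[phi | psi].
Proof. by rewrite bracketC bracketNr rmorphN /= -bracketC. Qed.

Lemma bracket_inj phi psi :
  (forall chi, '[chi | phi] = '[chi | psi]) -> phi = psi.
Proof.
move=> eq_br; apply/eqP; rewrite -subr_eq0; apply: contraT => /bracket_gt0.
by rewrite bracketDr bracketNr eq_br subrr ltxx.
Qed.

Section Operations.
Variables (a b : adjointable) (k : R[i]).

Lemma adjointableD : forall phi psi, a (phi + psi) = a phi + a psi.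
Proof. by move=> phi psi; have := adjointable_linear a 1 phi psi; rewrite !scale1r. Qed.

Lemma adjointable0 : a 0 = 0.
Proof. by apply: (addrI (a 0)); rewrite -adjointableD !addr0. Qed.

Lemma adjointableZ : forall l phi, a (l *: phi) = l *: a phi.
Proof.
by move=> l phi; have := adjointable_linear a l phi 0; rewrite adjointable0 !addr0.
Qed.

Definition adj_fun : D -> D := projT1 (cid (adjointableP a)).

Lemma adj_fun_linear : linear adj_fun.
Proof. by rewrite /adj_fun; case: cid => c []. Qed.

Lemma adj_funP : is_adjoint a adj_fun.
Proof. by rewrite /adj_fun; case: cid => c []. Qed.

Lemma adj_funP' : is_adjoint adj_fun a.
Proof. by move=> phi psi; rewrite bracketC -adj_funP -bracketC. Qed.

Definition adj : adjointable := Adjointable adj_fun_linear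
  (ex_intro _ (adjointable_fun a) (conj (adjointable_linear a) adj_funP')).

End Operations.

Lemma adjP a : is_adjoint a (adj a).
Proof. exact: adj_funP. Qed.

Lemma adj_unique a b : is_adjoint a b -> adj a = b.
Proof.
move=> hab; apply: adjointable_ext => phi; apply: bracket_inj => psi.
by rewrite bracketC -adjP hab -bracketC.
Qed.

Lemma opr_id_linear : linear (@id D). Proof. by []. Qed.

Definition adjointable_one := Adjointable opr_id_linear
  (ex_intro _ id (conj opr_id_linear (fun phi psi => erefl))).

Lemma adjointable_mul_linear a b : linear (a \o b).
Proof. by move=> k phi psi /=; rewrite !adjointable_linear. Qed.

Lemma adjointable_mulP a b : is_adjoint (a \o b) (adj b \o adj a).
Proof. by move=> phi psi /=; rewrite !adjP. Qed.

Definition adjointable_mul a b := Adjointable (adjointable_mul_linear a b)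
  (ex_intro _ _ (conj (adjointable_mul_linear (adj b) (adj a))
                      (adjointable_mulP a b))).

Lemma adjointable_zero_linear : linear (fun _ : D => 0 : D).
Proof. by move=> k phi psi /=; rewrite scaler0 addr0. Qed.

Lemma adjointable_zeroP : is_adjoint (fun _ => 0) (fun _ => 0).
Proof. by move=> phi psi; rewrite bracket0r bracketC bracket0r rmorph0. Qed.

Definition adjointable_zero := Adjointable adjointable_zero_linear
  (ex_intro _ _ (conj adjointable_zero_linear adjointable_zeroP)).

Lemma adjointable_add_linear a b : linear (fun phi => a phi + b phi).
Proof.
by move=> k phi psi /=; rewrite !adjointable_linear scalerDr addrACA.
Qed.

Lemma adjointable_addP a b :
  is_adjoint (fun phi => a phi + b phi) (fun phi => adj a phi + adj b phi).
Proof. by move=> phi psi /=; rewrite bracketDr bracketDl !adjP. Qed.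

Definition adjointable_add a b := Adjointable (adjointable_add_linear a b)
  (ex_intro _ _ (conj (adjointable_add_linear (adj a) (adj b))
                      (adjointable_addP a b))).

Lemma adjointable_scale_linear k a : linear (fun phi => k *: a phi).
Proof.
move=> l phi psi /=; rewrite adjointable_linear scalerDr.
by rewrite !scalerA mulrC.
Qed.

Lemma adjointable_scaleP k a :
  is_adjoint (fun phi => k *: a phi) (fun phi => k^* *: adj a phi).
Proof.
by move=> phi psi /=; rewrite bracketZr bracketZl conjCK adjP.
Qed.

Definition adjointable_scale k a := Adjointable (adjointable_scale_linear k a)
  (ex_intro _ _ (conj (adjointable_scale_linear k^* (adj a))
                      (adjointable_scaleP k a))).

Definition adjointable_opp a := adjointable_scale (-1) a.

Lemma adjointable_addA : associative adjointable_add.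
Proof. by move=> a b c; apply: adjointable_ext => phi /=; rewrite addrA. Qed.

Lemma adjointable_addC : commutative adjointable_add.
Proof. by move=> a b; apply: adjointable_ext => phi /=; rewrite addrC. Qed.

Lemma adjointable_add0 : left_id adjointable_zero adjointable_add.
Proof. by move=> a; apply: adjointable_ext => phi /=; rewrite add0r. Qed.

Lemma adjointable_addN :
  left_inverse adjointable_zero adjointable_opp adjointable_add.
Proof.
by move=> a; apply: adjointable_ext => phi /=; rewrite scaleN1r addNr.
Qed.

HB.instance Definition _ := GRing.isZmodule.Build adjointable
  adjointable_addA adjointable_addC adjointable_add0 adjointable_addN.

Lemma adjointable_scaleA k l a :
  adjointable_scale k (adjointable_scale l a) = adjointable_scale (k * l) a.
Proof. by apply: adjointable_ext => phi /=; rewrite scalerA. Qed.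

Lemma adjointable_scale1 : left_id 1 adjointable_scale.
Proof. by move=> a; apply: adjointable_ext => phi /=; rewrite scale1r. Qed.

Lemma adjointable_scaleDr : right_distributive adjointable_scale +%R.
Proof. by move=> k a b; apply: adjointable_ext => phi /=; rewrite scalerDr. Qed.

Lemma adjointable_scaleDl a : {morph adjointable_scale^~ a : k l / k + l}.
Proof. by move=> k l; apply: adjointable_ext => phi /=; rewrite scalerDl. Qed.

HB.instance Definition _ := GRing.Zmodule_isLmodule.Build R[i] adjointable
  adjointable_scaleA adjointable_scale1 adjointable_scaleDr adjointable_scaleDl.

Lemma adjointable_mulA : associative adjointable_mul.
Proof. by move=> a b c; apply: adjointable_ext. Qed.

Lemma adjointable_mul1l : left_id adjointable_one adjointable_mul.
Proof. by move=> a; apply: adjointable_ext. Qed.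

Lemma adjointable_mul1r : right_id adjointable_one adjointable_mul.
Proof. by move=> a; apply: adjointable_ext. Qed.

Lemma adjointable_mulDl : left_distributive adjointable_mul +%R.
Proof. by move=> a b c; apply: adjointable_ext. Qed.

Lemma adjointable_mulDr : right_distributive adjointable_mul +%R.
Proof. by move=> a b c; apply: adjointable_ext => phi /=; rewrite adjointableD. Qed.

Lemma adjointable_scaleAl k a b :
  k *: adjointable_mul a b = adjointable_mul (k *: a) b.
Proof. exact: adjointable_ext. Qed.

Lemma adjointable_scaleAr k a b :
  k *: adjointable_mul a b = adjointable_mul a (k *: b).
Proof. by apply: adjointable_ext => phi /=; rewrite adjointableZ. Qed.

Lemma adj_antilinear k a b : adj (k *: a + b) = k^* *: adj a + adj b.
Proof.
apply: adj_unique => phi psi /=.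
by rewrite bracketDr bracketZr bracketDl bracketZl conjCK !adjP.
Qed.

Lemma adjK : involutive adj.
Proof. by move=> a; apply: adj_unique; exact: adj_funP'. Qed.

Lemma adjM a b : adj (adjointable_mul a b) = adjointable_mul (adj b) (adj a).
Proof. by apply: adj_unique => phi psi /=; rewrite !adjP. Qed.

HB.instance Definition _ := isStarAlgebra.Build R adjointable
  adjointable_mulA adjointable_mul1l adjointable_mul1r
  adjointable_mulDl adjointable_mulDr adjointable_scaleAl adjointable_scaleAr
  adj_antilinear adjK adjM.

HB.instance Definition _ := GRing.Zmodule_isPzRing.Build adjointable
  adjointable_mulA adjointable_mul1l adjointable_mul1r
  adjointable_mulDl adjointable_mulDr.

Definition positive_operator a : Prop := forall phi, 0 <= '[phi | a phi].

Definition operator_le : rel (herm adjointable) :=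
  fun v w => `[< positive_operator (herm_val (w - v)) >].

Lemma operator_leP (v w : herm adjointable) :
  operator_le v w <->
  forall phi, '[phi | (herm_val v : adjointable) phi] <= '[phi | (herm_val w : adjointable) phi].
Proof.
have eq_br phi : '[phi | (herm_val (w - v) : adjointable) phi] =
    '[phi | (herm_val w : adjointable) phi] - '[phi | (herm_val v : adjointable) phi].
  by rewrite -[X in '[_ | X]]/((herm_val w : adjointable) phi +
    adjointable_opp (herm_val v : adjointable) phi) bracketDr /= scaleN1r bracketNr.
split=> [/asboolP h phi|h]; first by rewrite -subr_ge0 -eq_br.
by apply/asboolP => phi; rewrite eq_br subr_ge0.
Qed.

Lemma operator_le_refl : reflexive operator_le.
Proof. by move=> v; apply/operator_leP. Qed.

Lemma operator_le_trans : transitive operator_le.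
Proof.
move=> w v u /operator_leP h1 /operator_leP h2; apply/operator_leP => phi.
exact: le_trans (h1 phi) (h2 phi).
Qed.

Lemma half_sum (x y z t : R[i]) : x + y = z + t -> x - y = z - t -> x = z.
Proof.
move=> e1 e2; have : (x + y) + (x - y) = (z + t) + (z - t) by rewrite e1 e2.
rewrite [LHS]addrACA [RHS]addrACA !subrr !addr0 -!mulr2n => /eqP.
by rewrite eqrMn2r => /eqP.
Qed.

Lemma polarization (a b : adjointable) :
  (forall phi, '[phi | a phi] = '[phi | b phi]) -> a = b.
Proof.
move=> hab.
have sym phi psi : '[phi | a psi] + '[psi | a phi] =
                   '[phi | b psi] + '[psi | b phi].
  have := hab (phi + psi); rewrite !adjointableD !(bracketDr, bracketDl) !hab.
  by rewrite -!addrA => /addrI; rewrite !addrA => /addIr; rewrite addrC => ->; rewrite addrC.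
apply: adjointable_ext => psi; apply: bracket_inj => phi.
have h1 := sym phi psi.
have := sym phi ('i *: psi).
rewrite !adjointableZ !bracketZr !bracketZl.
rewrite conjCi !mulNr -!mulrBr.
move=> /(mulfI (neq0Ci _)) h2.
exact: half_sum h1 h2.
Qed.

Lemma operator_le_anti : antisymmetric operator_le.
Proof.
move=> v w /andP[/operator_leP h1 /operator_leP h2].
by apply/val_inj/polarization => phi; apply/eqP; rewrite eq_le h1 h2.
Qed.

Lemma operator_leD (u v w : herm adjointable) :
  operator_le v w -> operator_le (u + v) (u + w).
Proof.
by move=> /operator_leP h; apply/operator_leP => phi /=; rewrite !bracketDr lerD2l.
Qed.

Lemma operator_leZ (l : R) (v w : herm adjointable) :
  0 <= l -> operator_le v w -> operator_le (l *: v) (l *: w).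
Proof.
move=> l0 /operator_leP h; apply/operator_leP => phi /=.
by rewrite !bracketZr ler_wpM2l // ler0c.
Qed.

Lemma operator_le0P (v : herm adjointable) :
  operator_le 0 v <-> forall phi, 0 <= '[phi | (herm_val v : adjointable) phi].
Proof.
by split=> [/operator_leP h phi|h];
  [have := h phi | apply/operator_leP => phi]; rewrite /= bracket0r.
Qed.

Lemma operator_le01 : operator_le 0 herm_one.
Proof.
apply/operator_le0P => phi /=; have [->|/bracket_gt0/ltW//] := eqVneq phi 0.
by rewrite /= bracket0r.
Qed.

Lemma operator_le_conj (a : adjointable) (b : herm adjointable) :
  operator_le 0 b -> operator_le 0 (herm_conj a b).
Proof.
move=> /operator_le0P h; apply/operator_le0P => phi.
rewrite -[X in '[_ | X]]/(adj a ((herm_val b : adjointable) (a phi))).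
by rewrite [X in 0 <= X](adj_funP' a); exact: h.
Qed.

HB.instance Definition _ := isOrderedStarAlgebra.Build R adjointable
  operator_le_refl operator_le_anti operator_le_trans
  operator_leD operator_leZ operator_le01 operator_le_conj.

End AdjointableOperators.

Definition has_faithful_representation (R : realType)
    (A : orderedStarAlgebraType R) : Prop :=
  exists (D : lmodType R[i]) (dot : {dot D for @Num.conj R[i]})
         (pi : starHom A (adjointable dot)),
    @order_embedding R (herm A) (herm (adjointable dot)) (herm_hom pi).

(* Main.v *)
Require Import Defs.
From mathcomp Require Import reals.
From HB Require Import structures.
From mathcomp Require Import all_boot all_order all_algebra.
From mathcomp Require Import complex boolp classical_sets functions.
From mathcomp Require Import ring lra.

(* A representation by operators gives a closed algebra since inequalities of
   operators are tested on quadratic forms, which take values in an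
   Archimedean space.  Conversely, GNS turns the claim into: if v is not
   positive, some positive functional is negative at v.  The Archimedean
   property yields, one after the other, weights for the terms of the cofinal
   sequence such that v + w_n is never positive, where w_n is the weighted sum
   of the first n terms.  The wedge of all x with
   x + s (v + w_n) >= 0 for some s >= 0 and some n contains the positive cone
   but not v, and -v is an order unit for it; a maximal wedge above it that
   omits v defines the functional. *)

Set Implicit Arguments.
Unset Strict Implicit.
Unset Printing Implicit Defensive.

Import Order.TTheory GRing.Theory Num.Theory.

Local Open Scope ring_scope.

(** * Maximal wedges and the functionals they define *)

Section Wedge.
Variables (R : realType) (V : lmodType R).
Implicit Types (K : set V) (x y e : V) (s t : R).
Local Open Scope classical_set_scope.

Definition wedge K := (forall x y, K x -> K y -> K (x + y)) /\
  (forall t x, 0 <= t -> K x -> K (t *: x)).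

Lemma wedge_adjoin K x : wedge K ->
  wedge [set y + t *: x | y in K & t in [set t | 0 <= t]].
Proof.
move=> [KD KZ]; split.
  move=> _ _ [y Ky [s s0 <-]] [z Kz [t t0 <-]].
  exists (y + z); first exact: KD.
  by exists (s + t); [exact: addr_ge0|rewrite scalerDl addrACA].
move=> l _ l0 [y Ky [s s0 <-]].
exists (l *: y); first exact: KZ.
by exists (l * s); [exact: mulr_ge0|rewrite scalerDr scalerA].
Qed.

(** Take a wedge maximal among those omitting [- e]. If it omitted both [x] and [- x], adjoining
    either would produce [- e]; eliminating [x] from the two expressions puts [- e] in the wedge. *)
Lemma maximal_wedge K0 e : wedge K0 -> K0 e -> ~ K0 (- e) ->
  exists K, [/\ wedge K, K0 `<=` K, ~ K (- e) & forall x, K x \/ K (- x)].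
Proof.
move=> wK0 K0e K0Ne.
(* The empty set is allowed because Zorn's lemma covers the empty chain. *)
pose P K := [/\ wedge K, ~ K (- e) & (K = set0 \/ K0 `<=` K)].
have chain (F : set (set V)) :
    F `<=` P -> total_on F subset -> P (\bigcup_(X in F) X).
  move=> FP Ftot; split.
  - split=> [x y [X FX Xx] [Y FY Yy]|t x t0 [X FX Xx]].
      have [XY|YX] := Ftot X Y FX FY.
        by exists Y => //; have [[YD _] _ _] := FP Y FY; apply: YD => //;
          exact: XY.
      by exists X => //; have [[XD _] _ _] := FP X FX; apply: XD => //;
        exact: YX.
    by exists X => //; have [[_ XZ] _ _] := FP X FX; apply: XZ.
  - by move=> [X FX Xe]; have [_ + _] := FP X FX; apply.
  - have [[X [FX X0]]|noX] := pselect (exists X, F X /\ X !=set0).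
      have [_ _ [XE|K0X]] := FP X FX; first by move: X0; rewrite XE => -[].
      by right=> x /K0X Xx; exists X.
    left; apply/seteqP; split=> // x [X FX Xx].
    by apply: noX; exists X; split => //; exists x.
have [K [[wK KNe KE] Kmax]] := Zorn_bigcup chain.
have KK0 : K0 `<=` K.
  case: KE => // KE; exfalso.
  have := Kmax K0; rewrite KE; apply; last by split => //; right.
  by split=> // /(_ _ K0e).
exists K; split=> //.
have [KD KZ] := wK.
have K0' : K 0 by rewrite -(scale0r e); apply: KZ => //; exact: KK0.
(* By maximality the wedge generated by [K] and [x] contains [- e]; the coefficient of [x] is
   nonzero because [K] omits [- e]. *)
have adj x : ~ K x -> exists2 y, K y & exists2 t, 0 < t & y + t *: x = - e.
  move=> Kx; apply: contrapT => nx.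
  pose K' := [set y + t *: x | y in K & t in [set t | 0 <= t]].
  have KK' : K `<=` K'.
    by move=> y Ky; exists y => //; exists 0; rewrite /= ?scale0r ?addr0.
  apply: (Kmax K').
    split=> // K'K; apply/Kx/K'K; exists 0 => //; exists 1;
      rewrite /= ?ler01 //.
    by rewrite scale1r add0r.
  split; first exact: wedge_adjoin.
    move=> [y Ky [t]]; rewrite /= le_eqVlt => /predU1P[<-|t0 ye].
      by rewrite scale0r addr0 => ye; apply: KNe; rewrite -ye.
    by apply: nx; exists y => //; exists t.
  by right; exact: subset_trans KK'.
move=> x; have [|Kx] := pselect (K x); [by left|right].
apply: contrapT => KNx.
have [y Ky [s s0 ye]] := adj _ Kx; have [z Kz [t t0 ze]] := adj _ KNx.
apply: KNe.
have -> : - e = (s + t)^-1 *: (t *: y + s *: z).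
  rewrite (_ : t *: y + s *: z = (s + t) *: - e).
    by rewrite scalerA mulVf ?scale1r// gt_eqF// addr_gt0.
  have -> : y = - e - s *: x by rewrite -ye addrK.
  have -> : z = - e + t *: x by rewrite -ze scalerN subrK.
  rewrite !scalerDr addrACA !scalerN !scalerA (mulrC t) addNr addr0.
  by rewrite -opprD -scalerDl addrC.
by apply: (KZ); [rewrite invr_ge0 addr_ge0// ltW|apply: KD; apply: KZ => //;
  exact: ltW].
Qed.

(** The value at [x] is the supremum of the [t] with [x - t *: e] in a maximal wedge. As that wedge
    contains [y] or [- y] for each [y], every [x] defines a Dedekind cut. *)
Lemma wedge_state K0 e : wedge K0 -> K0 e -> ~ K0 (- e) ->
  (forall x, exists t, K0 (x + t *: e)) ->
  exists f : V -> R,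
    [/\ linear_for *%R f, forall x, K0 x -> 0 <= f x & f e = 1].
Proof.
move=> wK0 K0e K0Ne K0unit.
have [K [[KD KZ] KK0 KNe Ktot]] := maximal_wedge wK0 K0e K0Ne.
have Ke : K e by exact: KK0.
have Kpos t : K (t *: e) -> 0 <= t.
  move=> Kte; rewrite leNgt; apply/negP => t0; apply: KNe.
  have -> : - e = (- t)^-1 *: (t *: e).
    by rewrite scalerA invrN mulNr mulVf ?lt_eqF// scaleN1r.
  by apply: KZ => //; rewrite invr_ge0 oppr_ge0 ltW.
pose S x := [set t | K (x - t *: e)].
have S_le x s t : S x t -> K (s *: e - x) -> t <= s.
  rewrite /S /= => h1 h2; rewrite -subr_ge0; apply: Kpos.
  by rewrite scalerBl; have := KD _ _ h2 h1; rewrite addrA subrK.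
have ub x : exists s, K (s *: e - x).
  by have [t] := K0unit (- x); rewrite addrC => /KK0 ?; exists t.
have lb x : S x !=set0.
  by have [t] := K0unit x => /KK0 h; exists (- t); rewrite /S /= scaleNr opprK.
have Ssup x : has_sup (S x).
  by split => //; have [s xs] := ub x; exists s => t /S_le; apply.
pose f x := sup (S x).
have below x t : t < f x -> K (x - t *: e).
  move=> /(sup_gt (lb x))[s Sxs ts].
  have -> : x - t *: e = (x - s *: e) + (s - t) *: e
    by rewrite scalerBl addrA subrK.
  by apply: KD => //; apply: KZ => //; rewrite subr_ge0 ltW.
have above x t : f x < t -> K (t *: e - x).
  move=> ft; have [|] := Ktot (t *: e - x) => // Kx.
  exfalso; move: ft; apply/negP; rewrite -leNgt; apply: ub_le_sup;
    first by case: (Ssup x).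
  by rewrite /S /= -opprB.
(* Additivity, positive homogeneity and [f e = 1] all go through this criterion, which reads the
   value off the two sides of the cut. *)
have fE x r : (forall t, t < r -> K (x - t *: e)) ->
    (forall t, r < t -> K (t *: e - x)) -> f x = r.
  move=> lo hi; apply/eqP; rewrite eq_le; apply/andP; split; rewrite leNgt;
    apply/negP.
    move=> rf; have := S_le x _ _ (below x ((r + f x *+ 2) / 3) _)
      (hi ((r *+ 2 + f x) / 3) _).
    lra.
  move=> fr; have := S_le x _ _ (lo ((f x + r *+ 2) / 3) _)
    (above x ((f x *+ 2 + r) / 3) _).
  lra.
have fD x y : f (x + y) = f x + f y.
  apply: fE => t ht.
    (* The gap [f x + f y - t] is split evenly between [x] and [y]. *)
    have -> : x + y - t *: e = (x - (f x - (f x + f y - t) / 2) *: e) +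
       (y - (f y - (f x + f y - t) / 2) *: e).
      by rewrite addrACA -opprD -scalerDl; congr (_ - _ *: _); field.
    by apply: KD; apply: below; lra.
  have -> : t *: e - (x + y) = ((f x + (t - (f x + f y)) / 2) *: e - x) +
       ((f y + (t - (f x + f y)) / 2) *: e - y).
    by rewrite addrACA -opprD -scalerDl; congr (_ *: _ - _); field.
  by apply: KD; apply: above; lra.
have f0 : f 0 = 0 by apply: (addrI (f 0)); rewrite -fD !addr0.
have fN x : f (- x) = - f x by apply: (addrI (f x)); rewrite -fD !subrr f0.
have fZ_gt0 l x : 0 < l -> f (l *: x) = l * f x.
  move=> l0; apply: fE => t ht.
    have -> : l *: x - t *: e = l *: (x - (t / l) *: e).
      by rewrite scalerBr scalerA mulrCA divff ?gt_eqF// mulr1.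
    by apply: KZ (ltW l0) _; apply: below; rewrite ltr_pdivrMr// mulrC.
  have -> : t *: e - l *: x = l *: ((t / l) *: e - x).
    by rewrite scalerBr scalerA mulrCA divff ?gt_eqF// mulr1.
  by apply: KZ (ltW l0) _; apply: above; rewrite ltr_pdivlMr// mulrC.
have fZ l x : f (l *: x) = l * f x.
  have [l0|l0|->] := ltrgt0P l; [exact: fZ_gt0| |by rewrite scale0r mul0r].
  by rewrite -[l]opprK scaleNr fN fZ_gt0 ?oppr_gt0 ?mulNr ?opprK.
exists f; split=> [l x y|x /KK0 Kx|]; first by rewrite fD fZ.
  (* Adding [x] to [(f x / 2) *: e - x] leaves a negative multiple of [e] in [K]. *)
  rewrite leNgt; apply/negP => fx0; have := above x (f x / 2).
  have h : f x < f x / 2 by lra.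
  move=> /(_ h) /KD /(_ Kx); rewrite subrK => /Kpos h0; lra.
apply: fE => t ht.
  by rewrite -{1}[e]scale1r -scalerBl; apply: KZ => //; rewrite subr_ge0 ltW.
by rewrite -{2}[e]scale1r -scalerBl; apply: KZ => //; rewrite subr_ge0 ltW.
Qed.

End Wedge.

(** * Separating a point from the positive cone *)

Section OrderedVectorSpace.
Variables (R : realType) (V : orderedVectorSpaceType R).
Implicit Types (u v w : V) (t : R).

Lemma ovs_addr_ge0 v w : 0 <= v -> 0 <= w -> 0 <= v + w.
Proof. by move=> v0 w0; rewrite (le_trans v0)// -{1}[v]addr0 ovs_leD. Qed.

Lemma ovs_scale_ge0 t v : 0 <= t -> 0 <= v -> 0 <= t *: v.
Proof. by move=> t0 /(ovs_leZ _ _ _ t0); rewrite scaler0. Qed.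

Lemma ovs_subr_ge0 v w : (0 <= w - v) = (v <= w).
Proof.
apply/idP/idP => [/(ovs_leD v)|/(ovs_leD (- v))]; first by rewrite addr0 subrKC.
by rewrite addNr addrC.
Qed.

Lemma ovs_leZ_nneg s t v : s <= t -> 0 <= v -> s *: v <= t *: v.
Proof.
by move=> st v0; rewrite -ovs_subr_ge0 -scalerBl ovs_scale_ge0 // subr_ge0.
Qed.

(** Each step adds a multiple of [vhat n] too small to make [v + w n] positive; since every weight
    is nonzero, multiples of the [w n] still dominate every element. *)
Lemma sigma_bounded_cofinal v : archimedean V -> sigma_bounded V -> ~ 0 <= v ->
  exists w : nat -> V, [/\ forall n, 0 <= w n,
    forall m n, (m <= n)%N -> w m <= w n, forall n, ~ 0 <= v + w n
    & forall x, exists n t, 0 <= t /\ 0 <= x + t *: w n].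
Proof.
move=> arch [vhat [vhat0 _ vhat_cof]] v0.
(* The conditions on [p] stand under the existential so that choice gives a total function; when
   they fail, 1 serves. If no [e] worked, [- p.1 <= e *: p.2] for all [e > 0] would force
   [0 <= p.1]. *)
have step (p : V * V) : exists e : R, 0 < e /\
    (~ 0 <= p.1 -> 0 <= p.2 -> ~ 0 <= p.1 + e *: p.2).
  case: p => p q /=; apply: contrapT => ne.
  have q0 : 0 <= q.
    by apply: contrapT => nq; apply: ne; exists 1; split.
  have p0 : ~ 0 <= p.
    by move=> p0; apply: ne; exists 1; split.
  apply: p0; rewrite -[p]opprK -[- - p]add0r ovs_subr_ge0;
    apply: arch q0 _ => e e0.
  rewrite -ovs_subr_ge0 opprK addrC; apply: contrapT => ne'.
  by apply: ne; exists e.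
have [eps epsP] := choice step.
pose fix w n := if n is m.+1 then w m + eps (v + w m, vhat m) *: vhat m else 0.
have wS n : w n.+1 - w n = eps (v + w n, vhat n) *: vhat n
  by rewrite /= addrC addKr.
have w_le m n : (m <= n)%N -> w m <= w n.
  move=> /subnK <-; elim: (n - m)%N => // k /le_trans; apply.
  by rewrite addSn -ovs_subr_ge0 wS ovs_scale_ge0 // ltW //;
    case: (epsP (v + w (k + m)%N, vhat (k + m)%N)).
have w0 n : 0 <= w n by rewrite -[0]/(w 0%N) w_le.
exists w; split=> //.
  elim=> [|n IHn] /=; first by rewrite addr0.
  rewrite addrA; have [_] := epsP (v + w n, vhat n); apply;
    [exact: IHn|exact: vhat0].
move=> x; have [n /andP[xn _]] := vhat_cof x.
have [e0 _] := epsP (v + w n, vhat n); set e := eps _ in e0.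
have ei : 0 <= e^-1 by rewrite invr_ge0 ltW.
(* The term [vhat n] enters the sum at index [n.+1], and the inverse of its weight restores it to
   full size. *)
exists n.+1, e^-1; split => //.
rewrite /= scalerDr scalerA mulVf ?gt_eqF // scale1r addrCA.
rewrite ovs_addr_ge0 ?ovs_scale_ge0 //.
by rewrite -[vhat n]opprK ovs_subr_ge0.
Qed.

Lemma positive_functional_separation v :
    archimedean V -> sigma_bounded V -> ~ 0 <= v ->
  exists f : V -> R,
    [/\ linear_for *%R f, forall x, 0 <= x -> 0 <= f x & f v < 0].
Proof.
move=> arch sb v0; have [w [w0 w_le vw w_cof]] :=
  sigma_bounded_cofinal arch sb v0.
pose K x := exists s n, 0 <= s /\ 0 <= x + s *: (v + w n).
have cancel a b : v + a - (v + b) = a - b by rewrite opprD addrACA subrr add0r.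
have wK : wedge K.
  split=> [x y [s [m [s0 xs]]] [t [n [t0 yt]]]|l x l0 [s [n [s0 xs]]]].
    exists (s + t), (maxn m n); split; first exact: addr_ge0.
    apply: le_trans (ovs_addr_ge0 xs yt) _.
    rewrite addrACA scalerDl ovs_leD // -ovs_subr_ge0 opprD addrACA -!scalerBr.
    rewrite !cancel ovs_addr_ge0 // ovs_scale_ge0 //.
      by rewrite ovs_subr_ge0 w_le ?leq_maxl.
    by rewrite ovs_subr_ge0 w_le ?leq_maxr.
  exists (l * s), n; split; first exact: mulr_ge0.
  by rewrite -scalerA -scalerDr ovs_scale_ge0.
have K_pos x : 0 <= x -> K x by exists 0, 0%N; rewrite scale0r addr0.
have [||x|f [flin f0 fv]] := wedge_state (e := - v) wK.
- by exists 1, 0%N; split => //; rewrite scale1r addKr.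
(* If [v] were in [K], then [0 <= (1 + s) *: v + s *: w n]; dividing by [1 + s] and using
   [s <= 1 + s] contradicts [vw]. *)
- rewrite opprK => -[s [n [s0]]].
  rewrite -{1}[v]scale1r scalerDr addrA -scalerDl => vs.
  have s1 : 0 < 1 + s by rewrite ltr_pwDl.
  apply: (vw n); have si : 0 <= (1 + s)^-1 by rewrite invr_ge0 ltW.
  have := ovs_scale_ge0 si vs;
    rewrite scalerDr !scalerA mulVf ?gt_eqF // scale1r.
  move=> /le_trans; apply; rewrite ovs_leD // -{2}[w n]scale1r ovs_leZ_nneg //.
  by rewrite mulrC ler_pdivrMr // mul1r lerDr.
- have [n [t [t0 xt]]] := w_cof x; exists t, t, n; split => //.
  by rewrite scalerN scalerDr addrA subrK.
exists f; split=> // [x /K_pos/f0//|].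
have f00 : f 0 = 0.
  by have := flin 1 0 0; rewrite scaler0 addr0 mul1r => /eqP;
    rewrite -subr_eq subrr => /eqP.
have := flin (-1) (- v) 0.
by rewrite scaleN1r addr0 f00 addr0 fv opprK mulr1 => ->; rewrite oppr_lt0.
Qed.

End OrderedVectorSpace.

(** * Positive functionals on star algebras *)

Record positive_functional (R : realType) (A : starAlgebraType R) :=
  PositiveFunctional {
  pf_fun :> A -> R[i];
  pf_linear : linear_for *%R pf_fun;
  pf_star : forall a, pf_fun (star a) = (pf_fun a)^*;
  pf_ge0 : forall a, 0 <= pf_fun (star a * a)
}.

Section PositiveFunctional.
Variables (R : realType) (A : starAlgebraType R) (f : positive_functional A).
Implicit Types (a b : A) (k : R[i]).

Lemma pfD a b : f (a + b) = f a + f b.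
Proof. by have := pf_linear f 1 a b; rewrite scale1r mul1r. Qed.

Lemma pf0 : f 0 = 0.
Proof. by apply: (addrI (f 0)); rewrite -pfD !addr0. Qed.

Lemma pfZ k a : f (k *: a) = k * f a.
Proof. by have := pf_linear f k a 0; rewrite pf0 !addr0. Qed.

Lemma pf_sum (T : Type) (s : seq T) (P : pred T) (F : T -> A) :
  f (\sum_(x <- s | P x) F x) = \sum_(x <- s | P x) f (F x).
Proof. exact: (big_morph _ pfD pf0). Qed.

End PositiveFunctional.

(** * The direct sum of the GNS representations of a family of functionals *)

Section GNS.
Variables (R : realType) (A : starAlgebraType R) (I : eqType).
Variable om : I -> positive_functional A.
Implicit Types (a b c : A) (k : R[i]) (i : I) (s t : seq (I * A)).

Local Notation fT := (I * A -> R[i]).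

(* The class of the finite sum of the vectors [c] of the GNS space of [om i],
   for [(i, c)] in [s], is represented by the function giving its inner products
   with all [(i, a)], so that no quotient is needed. *)
Definition gns_vec s : fT :=
  fun x => \sum_(y <- s | y.1 == x.1) om x.1 (star x.2 * y.2).

Lemma gns_vec_cat s t : gns_vec (s ++ t) = gns_vec s + gns_vec t.
Proof. by apply/funext => x; rewrite /gns_vec big_cat. Qed.

Definition gns_act a s := [seq (x.1, a * x.2) | x <- s].

(** Left multiplication by [a] passes to the argument as [star a], so the operator can be defined on
    functions without choosing a sequence. *)
Lemma gns_vec_act a s x :
  gns_vec (gns_act a s) x = gns_vec s (x.1, star a * x.2).
Proof.
rewrite /gns_vec /gns_act big_map; apply: eq_bigr => y _ /=.
by rewrite starM starK mulrA.
Qed.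

Lemma gns_vec_scale k s :
  gns_vec [seq (x.1, k *: x.2) | x <- s] = k *: gns_vec s.
Proof.
apply/funext => x; rewrite /gns_vec big_map /=.
rewrite -[RHS]/(k * gns_vec s x) /gns_vec mulr_sumr; apply: eq_bigr => y _.
by rewrite -pfZ; congr (om _ _); exact/esym/sa_scaleAr.
Qed.

Definition gns_pred : {pred fT} := [pred g | `[< exists s, g = gns_vec s >]].

Lemma gns_predP g : reflect (exists s, g = gns_vec s) (g \in gns_pred).
Proof. exact: asboolP. Qed.

Lemma gns_submod_closed : submod_closed gns_pred.
Proof.
split; first by apply/gns_predP; exists [::]; apply/funext => x;
  rewrite /gns_vec big_nil.
move=> k _ _ /gns_predP[s ->] /gns_predP[t ->]; apply/gns_predP.
by exists ([seq (x.1, k *: x.2) | x <- s] ++ t);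
  rewrite gns_vec_cat gns_vec_scale.
Qed.

HB.instance Definition _ :=
  GRing.isSubmodClosed.Build R[i] fT gns_pred gns_submod_closed.

Record gns := Gns { gns_val :> fT; gns_valP : gns_val \in gns_pred }.

HB.instance Definition _ := [isSub for gns_val].
HB.instance Definition _ := [Choice of gns by <:].
HB.instance Definition _ := [SubChoice_isSubLmodule of gns by <:].

Definition gns_seq (g : gns) : seq (I * A) :=
  projT1 (cid (elimT (gns_predP _) (gns_valP g))).

Lemma gns_seqE g : gns_val g = gns_vec (gns_seq g).
Proof. by rewrite /gns_seq; case: cid. Qed.

Lemma gns_of_subproof s : gns_vec s \in gns_pred.
Proof. by apply/gns_predP; exists s. Qed.

Definition gns_of s := Gns (gns_of_subproof s).

Definition gns_dot (g h : gns) : R[i] := \sum_(x <- gns_seq h) g x.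

Lemma gns_vec_sym s t :
  \sum_(x <- s) gns_vec t x = (\sum_(y <- t) gns_vec s y)^*.
Proof.
rewrite rmorph_sum /= /gns_vec.
under [RHS]eq_bigr do rewrite rmorph_sum /=.
rewrite (exchange_big_dep xpredT) //=; apply: eq_bigr => y _.
rewrite !(big_mkcond (fun _ => _ == _)); apply: eq_bigr => x _ /=.
rewrite eq_sym; case: eqP => // ->.
by rewrite -pf_star starM starK.
Qed.

(** Writing [g] too as a finite sum, symmetry leaves only values of [h], so the choice of sequence
    does not matter. *)
Lemma gns_dotE g h s : gns_val h = gns_vec s -> gns_dot g h = \sum_(x <- s) g x.
Proof.
move=> hs; rewrite /gns_dot gns_seqE.
by rewrite gns_vec_sym [RHS]gns_vec_sym -hs gns_seqE.
Qed.

Lemma gns_dot_sym g h : gns_dot g h = (-1) ^+ false * (gns_dot h g)^*.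
Proof. by rewrite expr0 mul1r /gns_dot !gns_seqE -gns_vec_sym. Qed.

(* Grouping the terms by index turns the double sum into one of squares. *)
Lemma gns_group s b :
  \sum_(x <- s) gns_vec s (x.1, b * x.2) =
  \sum_(i <- undup (map fst s)) om i
    (star (\sum_(x <- s | x.1 == i) x.2) * star b *
      \sum_(x <- s | x.1 == i) x.2).
Proof.
have sumE i : om i (star (\sum_(x <- s | x.1 == i) x.2) * star b *
      \sum_(x <- s | x.1 == i) x.2) =
    \sum_(x <- s | x.1 == i) gns_vec s (i, b * x.2).
  rewrite (big_morph (@star R A) (@starD R A) (@star0 R A)).
  rewrite -mulrA mulr_suml pf_sum; apply: eq_bigr => x _.
  rewrite mulr_sumr mulr_sumr pf_sum; apply: eq_bigr => y _.
  by rewrite starM mulrA.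
under [RHS]eq_bigr do rewrite sumE.
rewrite [RHS](exchange_big_dep xpredT) //= [LHS]big_seq [RHS]big_seq.
apply: eq_bigr => x xs; rewrite big_mkcond (bigD1_seq x.1) ?undup_uniq //=.
  by rewrite eqxx big1 ?addr0 // => i; rewrite eq_sym => /negPf ->.
by rewrite mem_undup map_f.
Qed.

Lemma gns_dot_ge0 g : 0 <= gns_dot g g.
Proof.
have := gns_group (gns_seq g) 1;
  under eq_bigr do rewrite mul1r -surjective_pairing.
rewrite /gns_dot gns_seqE => ->; apply: sumr_ge0 => i _.
by rewrite star1 mulr1 pf_ge0.
Qed.

Lemma gns_dot_linearl h : linear_for *%R (gns_dot^~ h).
Proof.
by move=> k g g'; rewrite /gns_dot /= big_split mulr_sumr.
Qed.

Lemma gns_dot_linearr g : linear_for (@Num.conj R[i] \; *%R) (gns_dot g).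
Proof.
move=> k h h'; rewrite !(gns_dot_sym g) !expr0 !mul1r gns_dot_linearl.
by rewrite rmorphD rmorphM.
Qed.

HB.instance Definition _ := bilinear_isBilinear.Build R[i] gns gns R[i]
  *%R (@Num.conj R[i] \; *%R) gns_dot (gns_dot_linearl, gns_dot_linearr).
HB.instance Definition _ := isHermitianSesquilinear.Build R[i] gns false
  (@Num.conj R[i]) gns_dot gns_dot_sym.

(** By a Cauchy-Schwarz argument a vector of norm 0 is orthogonal to all others; its values are
    conjugates of such inner products, so it vanishes. *)
Lemma gns_dot_gt0 g : g != 0 -> 0 < gns_dot g g.
Proof.
move=> g0; rewrite lt_neqAle gns_dot_ge0 andbT eq_sym.
apply: contra g0 => /eqP gg.
have dot0 h : gns_dot h g = 0.
  set z := gns_dot h g; apply/eqP; rewrite -normr_eq0 -sqrf_eq0 normCK.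
  set p := gns_dot h h; have p0 : 0 <= p by exact: gns_dot_ge0.
  (* This [l] makes [l * p - 2] negative, also when [p] is 0; the squared norm of [g] minus a
     suitable multiple of [h] then forces [z] to vanish. *)
  have l0 : 0 < (p + 1)^-1 by rewrite invr_gt0 ltr_wpDl.
  set l := (p + 1)^-1 in l0.
  have lR : l^* = l by apply/CrealP; rewrite realE ltW.
  have lp : l * p < 1 by rewrite mulrC ltr_pdivrMr ?mul1r ?ltrDl // ltr_wpDl.
  have : 0 <= l * (z * z^*) * (l * p - 2).
    have := gns_dot_ge0 (- (l * z^*) *: h + g).
    rewrite gns_dot_linearl !gns_dot_linearr /= gg addr0 -/z -/p.
    rewrite (gns_dot_sym g h) expr0 mul1r -/z !(rmorphN, rmorphM) /= conjCK lR.
    by congr (0 <= _); ring.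
  rewrite nmulr_lge0; last by rewrite subr_lt0 (lt_trans lp) // ltr1n.
  by rewrite pmulr_rle0 // => zz; rewrite eq_le zz mul_conjC_ge0.
apply/eqP/val_inj/funext => -[i c].
have := dot0 (gns_of [:: (i, c)]).
rewrite gns_dot_sym expr0 mul1r (@gns_dotE _ _ [:: (i, c)]) //.
by rewrite big_seq1 => /eqP; rewrite conjC_eq0 => /eqP.
Qed.

HB.instance Definition _ := isDotProduct.Build R[i] gns gns_dot gns_dot_gt0.

Lemma gns_op_subproof a (g : gns) :
  (fun x => g (x.1, star a * x.2)) \in gns_pred.
Proof.
apply/gns_predP; exists (gns_act a (gns_seq g)); apply/funext => x.
by rewrite gns_vec_act -gns_seqE.
Qed.

Definition gns_op a (g : gns) : gns := Gns (gns_op_subproof a g).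

Lemma gns_op_linear a : linear (gns_op a).
Proof. by move=> k g h; exact/val_inj. Qed.

Lemma gns_opE a (g : gns) :
  gns_val (gns_op a g) = gns_vec (gns_act a (gns_seq g)).
Proof. by apply/funext => x; rewrite gns_vec_act -gns_seqE. Qed.

(** Both inner products sum the values of [h] at the pairs [(i, star a * c)], for [(i, c)] in a
    sequence representing [g]. *)
Lemma gns_op_adjoint a : is_adjoint gns_dot (gns_op a) (gns_op (star a)).
Proof.
move=> g h; rewrite /bracket [RHS](gns_dotE _ (gns_opE _ _)).
rewrite /gns_dot big_map /=.
by apply: eq_bigr => x _.
Qed.

Definition gns_adjointable a : adjointable gns_dot :=
  Adjointable (gns_op_linear a)
    (ex_intro _ _ (conj (gns_op_linear (star a)) (gns_op_adjoint a))).

Lemma gns_adjointable_linear : linear gns_adjointable.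
Proof.
move=> k a b; apply: adjointable_ext => g; apply/val_inj/funext => x /=.
rewrite -[RHS]/(k * g (x.1, star a * x.2) + g (x.1, star b * x.2)).
rewrite !gns_seqE /gns_vec mulr_sumr -big_split; apply: eq_bigr => y _ /=.
rewrite !starM !starK -!mulrA -pfZ -pfD; congr (om _ _).
rewrite mulrDl mulrDr; congr (_ + _).
rewrite (_ : k *: a * y.2 = k *: (a * y.2)); last exact/esym/sa_scaleAl.
exact/esym/sa_scaleAr.
Qed.

Lemma gns_adjointable1 : gns_adjointable 1 = 1.
Proof.
apply: adjointable_ext => g; apply/val_inj/funext => x /=.
by rewrite star1 mul1r -surjective_pairing.
Qed.

Lemma gns_adjointableM : {morph gns_adjointable : a b / a * b}.
Proof.
move=> a b; apply: adjointable_ext => g; apply/val_inj/funext => x /=.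
by rewrite starM mulrA.
Qed.

Lemma gns_adjointable_star : {morph gns_adjointable : a / star a}.
Proof. by move=> a; apply/esym/adj_unique => g h; rewrite gns_op_adjoint. Qed.

Definition gns_hom := StarHom gns_adjointable_linear gns_adjointable1
  gns_adjointableM gns_adjointable_star.

(** One-term vectors give one direction; conversely, the quadratic form at any vector splits by
    index into such terms. *)
Lemma gns_hom_positive b :
  positive_operator (gns_hom b) <->
  forall i c, 0 <= om i (star c * b * c).
Proof.
have brE g : bracket gns_dot g (gns_hom b g) =
    \sum_(x <- gns_seq g) gns_vec (gns_seq g) (x.1, star b * x.2).
  by apply: eq_bigr => x _; rewrite -gns_seqE.
split=> [pos i c|pos g]; last first.
  by rewrite brE gns_group starK; apply: sumr_ge0.
pose g := gns_of [:: (i, c)]; have : 0 <= gns_dot (gns_op b g) g := pos g.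
rewrite (@gns_dotE _ _ [:: (i, c)]) // big_seq1 /= /gns_vec.
by rewrite big_cons big_nil eqxx addr0 /= starM starK.
Qed.

End GNS.

(** * Complex extension of real functionals on Hermitian elements *)

Section Complexification.
Variables (R : realType) (A : starAlgebraType R).
Variable phi : herm A -> R.
Hypothesis phi_linear : linear_for *%R phi.
Implicit Types (a b : A) (v : herm A).

Let phiD v w : phi (v + w) = phi v + phi w.
Proof. by have := phi_linear 1 v w; rewrite scale1r mul1r. Qed.

Let phi0 : phi 0 = 0.
Proof. by apply: (addrI (phi 0)); rewrite -phiD !addr0. Qed.

Let phiZ t v : phi (t *: v) = t * phi v.
Proof. by have := phi_linear t v 0; rewrite phi0 !addr0. Qed.

Lemma herm_double_subproof a : a + star a \in @hermitian_pred R A.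
Proof. by rewrite unfold_in /= starD starK addrC. Qed.

(** Twice the real part of [a]; the halving is left to the scalars. *)
Definition herm_double a : herm A := Herm (herm_double_subproof a).

Lemma herm_doubleD a b : herm_double (a + b) = herm_double a + herm_double b.
Proof. by apply: val_inj; rewrite /= starD addrACA. Qed.

Lemma herm_doubleZ x y a : herm_double (Complex x y *: a) =
  x *: herm_double a - y *: herm_double (Complex 0 (-1) *: a).
Proof.
apply: val_inj => /=; rewrite !starZ !scalerDr opprD addrACA !scalerA.
rewrite -!scaleNr -!scalerDl.
by congr (_ *: _ + _ *: _); apply/eqP; rewrite eq_complex /=; apply/andP;
  split; apply/eqP; ring.
Qed.

(* The imaginary part of the functional at [a] is its real part at [- i a]. *)
Definition complexify a : R[i] :=
  Complex (phi (herm_double a) / 2)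
    (phi (herm_double (Complex 0 (-1) *: a)) / 2).

Lemma complexify_linear : linear_for *%R complexify.
Proof.
move=> [x y] a b; rewrite /complexify scalerDr !herm_doubleD scalerA.
have -> : Complex 0 (-1) * Complex x y = Complex y (- x) :> R[i].
  by apply/eqP; rewrite eq_complex /=; apply/andP; split; apply/eqP; ring.
rewrite (herm_doubleZ x y) (herm_doubleZ y (- x)) !phiD -!scaleNr !phiZ.
by apply/eqP; rewrite eq_complex /=; apply/andP; split; apply/eqP; field.
Qed.

Lemma complexify_star a : complexify (star a) = (complexify a)^*.
Proof.
have dS : herm_double (star a) = herm_double a.
  by apply: val_inj; rewrite /= starK addrC.
have dNi : herm_double (Complex 0 (-1) *: star a) =
    - herm_double (Complex 0 (-1) *: a).
  apply: val_inj => /=; rewrite !starZ starK opprD -!scaleNr addrC.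
  by congr (_ *: _ + _ *: _); apply/eqP;
    rewrite eq_complex /= ?oppr0 ?opprK !eqxx.
rewrite /complexify dS dNi -[- _]scaleN1r phiZ.
by apply/eqP; rewrite eq_complex /= mulN1r mulNr !eqxx.
Qed.

Lemma complexify_herm v : complexify v = ((phi v)%:C)%C.
Proof.
have dv : herm_double v = 2%:R *: v.
  by apply: val_inj; rewrite /= herm_star -mulr2n -scaler_nat rmorph_nat.
have dNi : herm_double (Complex 0 (-1) *: (v : A)) = 0.
  apply: val_inj => /=; rewrite starZ herm_star -scalerDl.
  rewrite -[RHS](scale0r (v : A)).
  by congr (_ *: _); apply/eqP; rewrite eq_complex /= opprK addr0 addNr !eqxx.
rewrite /complexify dv dNi phi0 phiZ mul0r.
by apply/eqP; rewrite eq_complex /= eqxx andbT; apply/eqP; field.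
Qed.

End Complexification.

(** * Positive functionals on the ordered space of Hermitian elements *)

Record positive_form (R : realType) (A : orderedStarAlgebraType R) :=
  PositiveForm {
  form_fun :> herm A -> R;
  form_linear : linear_for *%R form_fun;
  form_ge0 : forall v, 0 <= v -> 0 <= form_fun v
}.

(** These functionals index the GNS direct sum, where indices have to be compared. *)
HB.instance Definition _ (R : realType) (A : orderedStarAlgebraType R) :=
  gen_eqMixin (positive_form A).

Section OrderedStarAlgebra.
Variables (R : realType) (A : orderedStarAlgebraType R).
Implicit Types (f : positive_form A) (a : A) (v : herm A).

Lemma complexify_conj f a v :
  complexify f (star a * herm_val v * a) = ((f (herm_conj a v))%:C)%C.
Proof. by rewrite -(complexify_herm (form_linear f)). Qed.

Lemma complexify_ge0 f a : 0 <= complexify f (star a * a).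
Proof.
have -> : star a * a = star a * herm_val (herm_one : herm A) * a
  by rewrite mulr1.
rewrite complexify_conj lecR; apply: form_ge0; apply: herm_le_conj.
exact: herm_le01.
Qed.

Definition complexified f : positive_functional A :=
  PositiveFunctional (complexify_linear (form_linear f))
    (complexify_star (form_linear f)) (complexify_ge0 f).

End OrderedStarAlgebra.

(** * Closedness of operator algebras and the equivalence *)

Lemma archimedean_embedding (R : realType) (V W : orderedVectorSpaceType R)
    (f : V -> W) :
  linear f -> order_embedding f -> archimedean W -> archimedean V.
Proof.
move=> flin [_ fle] archW v w w0 vw.
have f0 : f 0 = 0.
  by apply: (addrI (f 0)); have := flin 1 0 0; rewrite !scale1r addr0 => <-;
    rewrite addr0.
apply/fle; rewrite f0; apply: (archW _ (f w)); first by rewrite -f0; apply/fle.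
by move=> e /vw/fle; have := flin e w 0; rewrite f0 !addr0 => ->.
Qed.

(** At a fixed vector these are inequalities of complex numbers, which require equal imaginary parts
    and compare real parts; the claim reduces to real numbers. *)
Lemma operators_archimedean (R : realType) (D : lmodType R[i])
    (dot : {dot D for @Num.conj R[i]}) :
  closed_algebra (adjointable dot).
Proof.
move=> v w /operator_le0P w0 vw; apply/operator_leP => phi /=.
rewrite bracket0r.
have vw' (e : R) : 0 < e ->
    bracket dot phi ((herm_val v : adjointable dot) phi) <=
    (e%:C)%C * bracket dot phi ((herm_val w : adjointable dot) phi).
  by move=> /vw/operator_leP/(_ phi) /=; rewrite bracketZr.
move: (w0 phi) vw'; set p := bracket _ _ _; set q := bracket _ _ _.
case: p q => [p1 p2] [q1 q2]; rewrite !lecE /= => /andP[/eqP p2_0 _] qp.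
have q2_0 : q2 = 0.
  by have := qp 1 ltr01; rewrite lecE /= => /andP[/eqP <- _];
    rewrite p2_0 mulr0 mul0r addr0.
rewrite q2_0 eqxx /= leNgt; apply/negP => q1_gt0.
have qp1 (e : R) : 0 < e -> q1 <= e * p1.
  by move=> /qp; rewrite lecE /= => /andP[_]; rewrite mul0r subr0.
have p1_gt0 : 0 < p1 by rewrite (lt_le_trans q1_gt0) // -[p1]mul1r qp1.
(* For this [e] the bound reads [q1 <= q1 / 2]. *)
have := qp1 (q1 / p1 / 2); rewrite !divr_gt0 // => /(_ isT).
by rewrite mulrAC divfK ?gt_eqF //; lra.
Qed.

Theorem theorem4p10 (R : realType) (A : orderedStarAlgebraType R)
    (A_sigma_bounded : sigma_bounded_algebra A) :
  has_faithful_representation A <-> closed_algebra A.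
Proof.
split=> [[D [dot [pi pi_emb]]]|A_closed].
  apply: archimedean_embedding pi_emb _; last exact: operators_archimedean.
  by move=> t v w; apply: val_inj; rewrite /= star_hom_linear.
(* Summing over all positive functionals lets every non-positive Hermitian element be detected by
   one of them. *)
pose pi := gns_hom (@complexified R A).
have pi_le (v w : herm A) : v <= w <-> herm_hom pi v <= herm_hom pi w.
  have herm_homB : herm_hom pi w - herm_hom pi v = herm_hom pi (w - v).
    apply: val_inj => /=.
    have := star_hom_linear pi (-1) (herm_val v) (herm_val w).
    by rewrite !scaleN1r (addrC (- herm_val v)) (addrC (- pi _)) => <-.
  rewrite -(ovs_subr_ge0 v w) -(ovs_subr_ge0 (herm_hom pi v)) herm_homB;
    move: (w - v) => u {herm_homB v w}.
  have pos_u : 0 <= herm_hom pi u <-> positive_operator (pi (herm_val u)).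
    exact: operator_le0P.
  rewrite pos_u gns_hom_positive; split=> [u0 f c|pos].
    rewrite /= complexify_conj lecR; apply: form_ge0; exact: herm_le_conj.
  apply: contrapT => /(positive_functional_separation A_closed A_sigma_bounded).
  move=> [f [flin f0]]; apply/negP; rewrite -leNgt.
  (* Conjugation by 1 evaluates [f] at [u] itself. *)
  have := pos (PositiveForm flin f0) 1.
  rewrite [pf_fun _ _]complexify_conj lecR /=; congr (_ <= f _).
  by apply: val_inj; rewrite /= star1 mul1r mulr1.
exists _, _, pi; split=> // v w pi_vw.
by apply/eqP; rewrite eq_le; apply/andP; split; apply/pi_le; rewrite pi_vw.
Qed.
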